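(* Let $X_1,\dots,X_n$ be i.i.d. uniformly distributed on $\mathcal X$ and let $\lambda>0$ satisfy $\lambda\ge2\|\mathbf M\|_\infty$, where $\mathbf M=\frac1n\sum_{i=1}^n(Y_iX_i-\mathbb E(Y_iX_i))$. Consider the estimator $\hat A^{\lambda'}$ with $\lambda'=\lambda/(1-\delta)$ for some $0<\delta<1$, and set $\hat r=\mathrm{rank}(\hat A^{\lambda'})$. Then $$\hat r\le\mathrm{rank}(A_0).$$ If, in addition, $\min_{j:\sigma_j(A_0)\ne0}\sigma_j(A_0)\ge\lambda'm_1m_2$, then $$\hat r\ge\mathrm{rank}(A_0)$$ and $$\|\hat A^{\lambda'}-A_0\|_2^2\ge\frac{\delta^2}{4(1-\delta)^2}\,\mathrm{rank}(A_0)\,(\lambda m_1m_2)^2 .$$ (The conclusions hold for every realization of the data for which $\lambda\ge2\|\mathbf M\|_\infty$.)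
   Context: $(X_i,Y_i)$, $i=1,\dots,n$, are independent random pairs with $\mathbb E(Y_i\mid X_i)=\mathrm{tr}(X_i^\top A_0)$, $A_0\in\mathbb R^{m_1\times m_2}$. $\mathcal X=\{e_j(m_1)e_k(m_2)^\top:1\le j\le m_1,\,1\le k\le m_2\}$, where $e_k(d)$ are the canonical basis vectors of $\mathbb R^d$. $\sigma_1(A)\ge\sigma_2(A)\ge\dots$ are the singular values of $A$; $\|\cdot\|_1,\|\cdot\|_2,\|\cdot\|_\infty$ are the nuclear, Frobenius and operator norms; $\langle A,B\rangle=\mathrm{tr}(A^\top B)$. For $\lambda>0$ the estimator is the (unique) minimizer $$\hat A^\lambda=\mathop{\mathrm{argmin}}_{A\in\mathbb R^{m_1\times m_2}}\left(\frac1{m_1m_2}\|A\|_2^2-\Big\langle\frac2n\sum_{i=1}^nY_iX_i,A\Big\rangle+\lambda\|A\|_1\right).$$ *)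

(* Defs.v *)
From HB Require Import structures.
From mathcomp Require Import all_boot all_order all_algebra.
From mathcomp Require Import polyrcf.
From mathcomp Require Import all_classical all_reals all_analysis.

Set Implicit Arguments.
Unset Strict Implicit.
Unset Printing Implicit Defensive.

Import Order.TTheory GRing.Theory Num.Theory.
Local Open Scope classical_set_scope.
Local Open Scope ring_scope.

Section Norms.
Context {R : realType}.
Implicit Types m : nat.

(* Real roots of p, nondecreasing, each repeated according to multiplicity. *)
Definition real_roots (p : {poly R}) : seq R :=
  flatten [seq nseq (mup x p) x | x <- rootsR p].

(* Square roots of the m2 eigenvalues of A^T A (all real and nonnegative),
   nonincreasing.  When m1 < m2 the entries beyond the first minn m1 m2 ones
   are zeros. *)
Definition singular_values m1 m2 (A : 'M[R]_(m1, m2)) : seq R :=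
  rev [seq Num.sqrt x | x <- real_roots (char_poly (A^T *m A))].

(* 0-based: singular_value A j is sigma_{j+1}(A). *)
Definition singular_value m1 m2 (A : 'M[R]_(m1, m2)) (j : nat) : R :=
  nth 0 (singular_values A) j.

Definition mxdot m1 m2 (A B : 'M[R]_(m1, m2)) : R := \tr (A^T *m B).

Definition nuclear_norm m1 m2 (A : 'M[R]_(m1, m2)) : R :=
  \sum_(j < minn m1 m2) singular_value A j.

(* On column vectors this is the Euclidean norm. *)
Definition frobenius_norm m1 m2 (A : 'M[R]_(m1, m2)) : R :=
  Num.sqrt (\sum_i \sum_j A i j ^+ 2).

Definition operator_norm m1 m2 (A : 'M[R]_(m1, m2)) : R :=
  sup [set frobenius_norm (A *m x) |
       x in [set x : 'cV[R]_m2 | frobenius_norm x <= 1]].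

End Norms.

Section Probability.
Context {d : measure_display} {T : measurableType d} {R : realType}.
Variable P : probability T R.

(* The sigma-algebra sigma(X) generated by the entries of a matrix-valued X. *)
Definition sigma_mx m1 m2 (X : T -> 'M[R]_(m1, m2)) : set (set T) :=
  <<s \bigcup_jk preimage_set_system setT
        (fun w => X w jk.1 jk.2) measurable >>.

Definition sigma_pair m1 m2 (X : T -> 'M[R]_(m1, m2)) (Y : T -> R) :
    set (set T) :=
  <<s sigma_mx X `|` preimage_set_system setT Y measurable >>.

Definition independent_sigma (n : nat) (G : 'I_n -> set (set T)) : Prop :=
  forall E : 'I_n -> set T, (forall i, G i (E i)) ->
  forall J : {set 'I_n},
    P (\bigcap_(i in [set` J]) E i) = (\prod_(i in J) P (E i))%E.

(* Z is a version of E(Y | G), for an integrable Y. *)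
Definition is_cond_expectation (G : set (set T)) (Y Z : T -> R) : Prop :=
  [/\ P.-integrable setT (EFin \o Y), P.-integrable setT (EFin \o Z),
      preimage_set_system setT Z measurable `<=` G &
      forall E, G E ->
        (\int[P]_(w in E) (Y w)%:E = \int[P]_(w in E) (Z w)%:E)%E].

Definition mx_expectation m1 m2 (Z : T -> 'M[R]_(m1, m2)) : 'M[R]_(m1, m2) :=
  \matrix_(j, k) fine ('E_P[fun w => Z w j k])%E.

(* The set of the matrix units e_j e_k^T. *)
Definition mx_units m1 m2 : set 'M[R]_(m1, m2) :=
  [set delta_mx jk.1 jk.2 | jk in [set: 'I_m1 * 'I_m2]].

(* These m1 * m2 point masses sum to 1, hence determine the law of X. *)
Definition uniform_on_mx_units m1 m2 (X : T -> 'M[R]_(m1, m2)) : Prop :=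
  forall x, mx_units x -> P (X @^-1` [set x]) = (((m1 * m2)%:R)^-1)%:E.

Definition noise_mx n m1 m2 (X : 'I_n -> T -> 'M[R]_(m1, m2))
    (Y : 'I_n -> T -> R) (w : T) : 'M[R]_(m1, m2) :=
  n%:R^-1 *: \sum_(i < n)
    (Y i w *: X i w - mx_expectation (fun w' => Y i w' *: X i w')).

End Probability.

Section Estimator.
Context {R : realType}.

(* The arguments x i, y i are the observed values of (X_i, Y_i). *)
Definition objective n m1 m2 (x : 'I_n -> 'M[R]_(m1, m2)) (y : 'I_n -> R)
    (lambda : R) (A : 'M[R]_(m1, m2)) : R :=
  (m1 * m2)%:R^-1 * frobenius_norm A ^+ 2
  - mxdot ((2 / n%:R) *: \sum_(i < n) y i *: x i) A
  + lambda * nuclear_norm A.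

Definition is_estimator n m1 m2 (x : 'I_n -> 'M[R]_(m1, m2)) (y : 'I_n -> R)
    (lambda : R) (Ahat : 'M[R]_(m1, m2)) : Prop :=
  forall A, objective x y lambda Ahat <= objective x y lambda A.

End Estimator.

(* Main.v *)
Require Import Defs.
From HB Require Import structures.
From mathcomp Require Import all_boot all_order all_algebra.
From mathcomp Require Import polyrcf complex ring lra.
From mathcomp Require Import all_classical all_reals all_analysis.
From mathcomp Require Import measurable_realfun.

(* Since E(Y_i X_i) = A0 / (m1 m2), the estimator minimizes
   |A - W|^2 / 2 + tau |A|_1 with W = A0 + m1 m2 M and tau = m1 m2 lambda' / 2,
   while |m1 m2 M| <= (1 - delta) tau in operator norm.  Hence C = W - Ahat has
   operator norm at most tau, and C v_j = tau u_j for the singular vectors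
   u_j, v_j of Ahat of nonzero singular value s_j.
   - On the span of these v_j, W v_j = (s_j + tau) u_j, so W stretches by at
     least tau, more than m1 m2 M can; hence A0 is injective there.
   - Under the gap condition A0 stretches its row space by at least 2 tau.
     A vector y of it killed by Ahat has W y = C y, of norm at most tau |y|,
     whereas |W y| >= 2 tau |y| - (1 - delta) tau |y|; hence y = 0.
   - Each u_j^T (A0 - Ahat) v_j = tau - u_j^T (m1 m2 M) v_j is at least
     delta tau, and there are rank A0 of them. *)

Set Implicit Arguments.
Unset Strict Implicit.
Unset Printing Implicit Defensive.

Import Order.TTheory GRing.Theory Num.Theory.
Local Open Scope classical_set_scope.
Local Open Scope ring_scope.

(** * Spectral theorem and singular values *)

(** Over the complex numbers [S] is Hermitian, hence unitarily diagonalizable with real diagonal. A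
    nonzero diagonal entry exists as [S] is nonzero; being real, it is a root of the characteristic
    polynomial over [R]. *)
Lemma sym_eigenvalue_neq0 (R : rcfType) n (S : 'M[R]_n) :
  S^T = S -> S != 0 -> exists2 r, r != 0 & eigenvalue S r.
Proof.
move=> symS S0; pose f := real_complex R; pose SC := map_mx f S.
have SCreal : SC \is a mxOver Num.real.
  by apply/mxOverP => i j; rewrite mxE; apply/complex_realP; exists (S i j).
have SCherm : SC \is hermsymmx.
  apply: realsym_hermsym => //; apply/is_hermitianmxP.
  by rewrite expr0 scale1r; apply/matrixP => i j; rewrite !mxE -[in LHS]symS mxE.
have [SCE] := (orthomx_spectralP (hermitian_normalmx SCherm),
               hermitian_spectral_diag_real SCherm).
set P := spectralmx SC in SCE *; set D := spectral_diag SC in SCE *.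
move=> /mxOverP Dreal.
have [i Di0] : exists i, D 0 i != 0.
  apply/existsP; apply: contraNT S0; rewrite negb_exists => /forallP D0.
  have {}D0 : D = 0.
    by apply/rowP => i; have /negPn/eqP -> := D0 i; rewrite mxE.
  have SC0 : SC = 0.
    have E0 : diag_mx D = 0 by apply/matrixP => i j; rewrite D0 !mxE mul0rn.
    by rewrite SCE E0 mulmx0 mul0mx.
  apply/eqP/matrixP => j k; apply: (@complexI R).
  by move/matrixP/(_ j k): SC0; rewrite !mxE.
have [r Dir] := complex_realP _ (Dreal 0 i).
exists r; first by apply: contra_neq Di0 => r0; rewrite Dir r0.
rewrite eigenvalue_root_char -(fmorph_root f) map_char_poly
  -eigenvalue_root_char.
apply/eigenvalueP; exists (row i P).
  rewrite -/f -/SC [in LHS]SCE mulmxA mulmxA -row_mul mulmxV ?spectral_unit //.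
  by rewrite -row_mul mul1mx row_diag_mx -scalemxAl -rowE Dir.
apply/eqP => Pi0; have := mulmxK (spectral_unit SC) (delta_mx (0 : 'I_1) i).
rewrite -/P -rowE Pi0 mul0mx => /matrixP/(_ 0 i)/eqP.
by rewrite !mxE !eqxx eq_sym oner_eq0.
Qed.

(** Induction on the number [k] of orthonormal eigenvectors found so far, stored as the rows of
    [V]. *)
Lemma sym_spectral (R : rcfType) n (S : 'M[R]_n) : S^T = S ->
  exists (V : 'M[R]_n) (D : 'rV[R]_n),
    V *m V^T = 1%:M /\ V *m S = diag_mx D *m V.
Proof.
move=> symS.
suff: forall k, (k <= n)%N -> exists (V : 'M[R]_(k, n)) (D : 'rV[R]_k),
    V *m V^T = 1%:M /\ V *m S = diag_mx D *m V by apply.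
elim=> [_|k IHk lt_kn].
  by exists 0, 0; split; rewrite [LHS]flatmx0 [RHS]flatmx0.
have [V [D [VVT VS]]] := IHk (ltnW lt_kn).
(* The span of V is sent to 0 by the symmetric S', so that eigenvectors of S'
   for nonzero eigenvalues are orthogonal to it. *)
have [c S'0] : exists c : R,
    S - V^T *m diag_mx D *m V + c *: (1%:M - V^T *m V) != 0.
  (* Should deflating [S] leave 0, the projection onto the orthogonal complement is added; it is
     nonzero because [k < n]. *)
  have I0 : 1%:M - V^T *m V != 0.
    rewrite subr_eq0; apply/eqP => /(congr1 mxrank) I0; move: lt_kn.
    rewrite -[X in (_ < X)%N](mxrank1 R) I0 ltnNge.
    by rewrite (leq_trans (mxrankM_maxr _ _)) ?rank_leq_row.
  have [->|S0] := eqVneq (S - V^T *m diag_mx D *m V) 0.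
    by exists 1; rewrite add0r scale1r.
  by exists 0; rewrite scale0r addr0.
move: S'0; set S' := _ + _ => S'0.
have symS' : S'^T = S'.
  rewrite /S' raddfD raddfB /= linearZ /= raddfB /= trmx1 !trmx_mul !trmxK.
  by rewrite tr_diag_mx symS mulmxA.
have VS' : V *m S' = 0.
  rewrite /S' mulmxDr mulmxBr -scalemxAr mulmxBr !mulmxA VVT !mul1mx mulmx1.
  by rewrite VS !subrr scaler0 addr0.
have [r r0 /eigenvalueP[v vS' v0]] := sym_eigenvalue_neq0 symS' S'0.
have Vv : V *m v^T = 0.
  apply: (scalerI r0); rewrite scaler0 scalemxAr -linearZ /= -vS' trmx_mul.
  by rewrite symS' mulmxA VS' mul0mx.
have vV : v *m V^T = 0 by apply: trmx_inj; rewrite trmx_mul trmxK trmx0.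
(* On the complement of the rows of [V], [S'] acts as [S] plus [c], so the shift is undone. *)
have vS : v *m S = (r - c) *: v.
  move: vS'; rewrite /S' mulmxDr mulmxBr -scalemxAr mulmxBr !mulmxA vV.
  by rewrite !mul0mx !subr0 mulmx1 => /(canRL (addrK _)) ->; rewrite scalerBl.
have vv : 0 < (v *m v^T) 0 0.
  have vvE : (v *m v^T) 0 0 = \sum_i v 0 i ^+ 2.
    by rewrite mxE; apply: eq_bigr => i _; rewrite mxE.
  rewrite vvE lt_def sumr_ge0 ?andbT => [|i _]; last exact: sqr_ge0.
  rewrite psumr_eq0 => [|i _]; last exact: sqr_ge0.
  apply: contra_neqN v0 => /allP v0; apply/rowP => i; rewrite mxE.
  by apply/eqP; rewrite -sqrf_eq0; apply: (implyP (v0 _ (mem_index_enum i))).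
rewrite -[k.+1]/(1 + k)%N.
pose a := (Num.sqrt ((v *m v^T) 0 0))^-1; exists (col_mx (a *: v) V).
exists (row_mx (r - c)%:M D).
split.
  rewrite tr_col_mx mul_col_row [(a *: v)^T]linearZ /= -!scalemxAl
    -!scalemxAr vV Vv VVT.
  rewrite !scaler0 scalerA [v *m _]mx11_scalar scale_scalar_mx.
  rewrite -expr2 /a exprVn sqr_sqrtr ?ltW // mulVf ?gt_eqF //.
  by rewrite -scalar_mx_block.
rewrite mul_col_mx -scalemxAl vS VS diag_mx_row mul_block_col.
rewrite !mul0mx addr0 add0r scalerA.
have -> : diag_mx (r - c)%:M = (r - c)%:M :> 'M[R]_1.
  by apply/matrixP => i j; rewrite !ord1 !mxE.
by rewrite mul_scalar_mx scalerA mulrC.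
Qed.

Lemma mxrank_diag_le (F : fieldType) n (d : 'rV[F]_n) :
  (\rank (diag_mx d) <= #|[pred i | d ord0 i != 0%R]|)%N.
Proof.
have -> : diag_mx d = \sum_i d 0 i *: delta_mx i i.
  apply/matrixP => i j; rewrite summxE (bigD1 i) //= big1 => [|k ki].
    rewrite !mxE eqxx addr0 /= [j == i]eq_sym.
    by case: (i == j); rewrite ?mulr1 ?mulr0.
  by rewrite !mxE eq_sym (negPf ki) mulr0.
rewrite -sum1_card [leqRHS]big_mkcond /=.
apply: (big_rec2 (fun (B : 'M[F]_n) k => (\rank B <= k)%N)) => [|i B k _ IH].
  by rewrite mxrank0.
apply: leq_trans (mxrank_add _ _) _; apply: leq_add IH.
rewrite inE; have [->|di] := eqVneq (d 0 i) 0.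
  by rewrite scale0r mxrank0.
by rewrite mxrank_scale_nz // mxrank_delta.
Qed.

(** Rank-nullity; the transposes are there because [kermx] is a kernel of row vectors. *)
Lemma mxrank_le_ker (F : fieldType) m1 m2 n (P : 'M[F]_(m1, n))
    (Q : 'M[F]_(m2, n)) :
  (forall z : 'cV_n, P *m z = 0 -> Q *m z = 0) -> (\rank Q <= \rank P)%N.
Proof.
move=> PQ; have : (kermx P^T <= kermx Q^T)%MS.
  apply/row_subP => i; apply/sub_kermxP; apply: trmx_inj.
  rewrite trmx_mul trmxK trmx0; apply: PQ; apply: trmx_inj.
  by rewrite trmx_mul trmxK trmx0; apply/sub_kermxP; apply: row_sub.
move/mxrankS; rewrite !mxrank_ker !mxrank_tr => PQr.
by rewrite -(leq_sub2lE _ (rank_leq_col Q)).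
Qed.

Lemma char_poly_conj (R : comUnitRingType) n (S V : 'M[R]_n) (D : 'rV[R]_n) :
  V *m V^T = 1%:M -> S = V^T *m diag_mx D *m V ->
  char_poly S = \prod_(x <- [seq D 0 i | i <- enum 'I_n]) ('X - x%:P).
Proof.
move=> VVT ->; have VTV := mulmx1C VVT.
have -> : char_poly (V^T *m diag_mx D *m V) = char_poly (diag_mx D).
  rewrite /char_poly /char_poly_mx !map_mxM /=.
  have XE : 'X%:M = map_mx polyC V^T *m 'X%:M *m map_mx polyC V :> 'M[{poly R}]_n.
    by rewrite mul_mx_scalar -scalemxAl -map_mxM VTV map_mx1 scalemx1.
  rewrite [in LHS]XE -mulmxBl -mulmxBr !det_mulmx mulrAC -det_mulmx -map_mxM VTV.
  by rewrite map_mx1 det1 mul1r.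
rewrite char_poly_trig ?diag_mx_is_trig // big_map big_enum.
by apply: eq_bigr => i _; rewrite mxE eqxx mulr1n.
Qed.

(** * Real roots of split polynomials *)

Section RealRoots.
Variable R : realType.

(** Occurrences are counted: only the block of the root [y] contains [y], and its length is the
    multiplicity of [y]. *)
Lemma real_roots_prod_XsubC (s : seq R) :
  perm_eq (real_roots (\prod_(x <- s) ('X - x%:P))) s.
Proof.
set p := \prod_(x <- _) _.
have p0 : p != 0 by rewrite monic_neq0 ?monic_prod_XsubC.
apply/allP => y _; apply/eqP.
rewrite /= /real_roots count_flatten -map_comp.
have -> : [seq (count_mem y \o (fun x => nseq (mup x p) x)) i | i <- rootsR p]
    = [seq (if i == y then mup y p else 0)%N | i <- rootsR p].
  apply: eq_map => x /=; rewrite count_nseq /=.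
  by case: eqP => [->|]; rewrite ?mul1n ?mul0n.
rewrite -[RHS]mu_prod_XsubC -/p.
have [yr|yr] := boolP (y \in rootsR p).
  rewrite sumnE big_map (bigD1_seq y) ?uniq_roots //= eqxx big1 ?addn0 //.
  by move=> x /negPf ->.
rewrite mupNroot; last first.
  by have := roots_on_rootsR p0 y; rewrite in_itv /= (negPf yr) => ->.
by rewrite sumnE big_map big1_seq // => x _; case: ifP.
Qed.

Lemma sorted_real_roots (p : {poly R}) : sorted <=%R (real_roots p).
Proof.
rewrite /real_roots; have := sorted_roots (- cauchy_bound p) (cauchy_bound p) p.
rewrite -/(rootsR p) (sorted_pairwise lt_trans) (sorted_pairwise le_trans).
elim: (rootsR p) => //= x s IHs /andP[xs /IHs ps].
rewrite pairwise_cat ps andbT; apply/andP; split.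
  apply/allrelP => y z; rewrite mem_nseq => /andP[_ /eqP ->].
  case/flatten_mapP => t ts; rewrite mem_nseq => /andP[_ /eqP ->].
  by rewrite ltW //; apply: (allP xs).
by elim: (mup x p) => //= k ->; rewrite andbT all_nseq lexx orbT.
Qed.

End RealRoots.

(** A nonzero entry at [j] would be positive, and so would the [j + 1] entries up to it, more than
    the [k] allowed. *)
Lemma nonincreasing_drop_eq0 (R : realDomainType) (t : seq R) k j :
  sorted >=%R t -> {in t, forall x, 0 <= x} ->
  (count (fun x => x != 0%R) t <= k <= j)%N -> nth 0 t j = 0.
Proof.
move=> st t0 /andP[tk kj]; have [jt|] := ltnP j (size t); last exact: nth_default.
apply/eqP; apply: contraTT tk => tj0; rewrite -ltnNge (leq_ltn_trans kj) //.
have tj : 0 < nth 0 t j by rewrite lt_def tj0 t0 ?mem_nth.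
rewrite -[t in count _ t](cat_take_drop j.+1) count_cat.
rewrite (leq_trans _ (leq_addr _ _)) //.
suff : all (fun x => x != 0) (take j.+1 t).
  by rewrite all_count size_takel // => /eqP ->.
apply/(all_nthP 0) => i; rewrite size_takel // => ij; rewrite nth_take // gt_eqF //.
apply: lt_le_trans tj _; rewrite ltnS in ij.
have ge_trans : transitive (>=%R : rel R).
  by move=> x y z xy yz; apply: le_trans yz xy.
have := sorted_leq_nth ge_trans (@lexx _ R) 0 st; apply=> //; rewrite !inE.
exact: leq_ltn_trans jt.
Qed.

(** * Singular value decomposition *)

(** The orthogonal projection onto the support of [s]. It replaces the identity in [U^T *m U], since
    [U] cannot have [m2] orthonormal columns when [m1 < m2]. *)
Definition suppmx (R : pzRingType) n (s : 'rV[R]_n) : 'M[R]_n :=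
  diag_mx (\row_i (s 0 i != 0)%:R).

Lemma mul_diag_suppmx (R : comPzRingType) n (s : 'rV[R]_n) :
  diag_mx s *m suppmx s = diag_mx s.
Proof.
rewrite mulmx_diag; congr diag_mx; apply/rowP => i; rewrite !mxE.
by have [->|_] := eqVneq (s 0 i) 0; rewrite ?mulr1 ?mulr0.
Qed.

(* The columns of U indexed by the support of s are orthonormal, the others
   vanish. *)
Definition is_svd (R : numDomainType) m1 m2 (A : 'M[R]_(m1, m2))
    (U : 'M[R]_(m1, m2)) (V : 'M[R]_m2) (s : 'rV[R]_m2) :=
  [/\ A = U *m diag_mx s *m V, V *m V^T = 1%:M,
      U^T *m U = suppmx s & forall i, 0 <= s 0 i].

Section SVD.
Variable R : realType.

Lemma trmx_mul_self_ge0 m n (A : 'M[R]_(m, n)) i : 0 <= (A^T *m A) i i.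
Proof. by rewrite mxE sumr_ge0 // => j _; rewrite mxE -expr2 sqr_ge0. Qed.

Lemma trmx_mul_self_eq0 m n (A : 'M[R]_(m, n)) i :
  (A^T *m A) i i = 0 -> col i A = 0.
Proof.
rewrite mxE => /eqP; rewrite psumr_eq0 => [/allP A0|j _].
  apply/colP => j; rewrite !mxE; have := A0 j (mem_index_enum j).
  by rewrite mxE mulf_eq0 orbb => /eqP.
by rewrite mxE -expr2 sqr_ge0.
Qed.

(** [V] diagonalizes [A^T *m A], [s] consists of the square roots of its eigenvalues, and [U] of the
    normalized images of the eigenvectors. *)
Lemma svd_exists m1 m2 (A : 'M[R]_(m1, m2)) : exists U V s, is_svd A U V s.
Proof.
have [|V [D [VVT VS]]] := @sym_spectral R _ (A^T *m A).
  by rewrite trmx_mul trmxK.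
pose W := A *m V^T; pose s := \row_i Num.sqrt (D 0 i).
have WTW : W^T *m W = diag_mx D.
  by rewrite /W trmx_mul trmxK !mulmxA -[V *m _ *m A]mulmxA VS -mulmxA VVT mulmx1.
have D0 i : 0 <= D 0 i.
  by have := trmx_mul_self_ge0 W i; rewrite WTW mxE eqxx mulr1n.
(* As [0^-1 = 0], the columns of [U] outside the support of [s] vanish. *)
pose s' := \row_i (s 0 i)^-1; pose U := W *m diag_mx s'.
have UTU : U^T *m U = suppmx s.
  rewrite /U trmx_mul tr_diag_mx mulmxA -[diag_mx s' *m _ *m _]mulmxA WTW.
  rewrite !mulmx_diag; congr diag_mx; apply/rowP => i; rewrite !mxE.
  have [->|Di0] := eqVneq (Num.sqrt (D 0 i)) 0; first by rewrite invr0 mulr0.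
  by rewrite -[D 0 i in X in _ * X * _]sqr_sqrtr // expr2 mulrA mulVf // mul1r divff.
have Us : U *m diag_mx s = W.
  apply/matrixP => i j; rewrite mul_mx_diag /U mul_mx_diag !mxE.
  have [Dj0|Dj0] := eqVneq (Num.sqrt (D 0 j)) 0; last by rewrite mulfVK.
  (* Where [s] vanishes, so does the column of [W], its squared norm being [D 0 j]. *)
  suff /colP/(_ i) : col j W = 0 by rewrite !mxE Dj0 mulr0 => ->.
  apply: trmx_mul_self_eq0; rewrite WTW mxE eqxx mulr1n; apply/eqP.
  by rewrite eq_le D0 -sqrtr_eq0 Dj0 eqxx.
exists U, V, s; split=> // [|i]; last by rewrite mxE sqrtr_ge0.
by rewrite Us /W -mulmxA (mulmx1C VVT) mulmx1.
Qed.

Variables (m1 m2 : nat) (A U : 'M[R]_(m1, m2)) (V : 'M[R]_m2) (s : 'rV[R]_m2).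
Hypothesis svdA : is_svd A U V s.

Lemma svd_Gram : A^T *m A = V^T *m diag_mx (\row_i s 0 i ^+ 2) *m V.
Proof.
have [-> VVT UTU s0] := svdA.
transitivity (V^T *m (diag_mx s *m (U^T *m U) *m diag_mx s) *m V).
  by rewrite !trmx_mul tr_diag_mx !mulmxA.
by rewrite UTU mul_diag_suppmx mulmx_diag.
Qed.

(** The eigenvalues of [A^T *m A] are the squares of the nonnegative [s 0 i]. This ties the
    definition through [char_poly] to any decomposition. *)
Lemma singular_values_svd :
  perm_eq (singular_values A) [seq s 0 i | i <- enum 'I_m2].
Proof.
have [_ VVT _ s0] := svdA.
rewrite /singular_values perm_rev (char_poly_conj VVT svd_Gram).
apply: perm_trans (perm_map _ (real_roots_prod_XsubC _)) _.
rewrite -map_comp; apply/permP => a; congr count; apply: eq_map => i.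
by rewrite /= mxE sqrtr_sqr ger0_norm.
Qed.

Lemma card_svd_supp : (#|[pred i | s ord0 i != 0%R]| <= minn m1 m2)%N.
Proof.
have [_ _ UTU _] := svdA.
rewrite leq_min; apply/andP; split; last by rewrite -[leqRHS]card_ord max_card.
(* [mxrank_diag_le] bounds ranks from above only, so the support is counted through the
   complementary projection. *)
have : (m2 <= \rank (suppmx s) + \rank (1%:M - suppmx s)%R)%N.
  by rewrite -[leqLHS](mxrank1 R) -[X in \rank X](subrK (suppmx s)) addnC mxrank_add.
have rU : (\rank (suppmx s) <= m1)%N.
  by rewrite -UTU (leq_trans (mxrankM_maxr _ _)) ?rank_leq_row.
have -> : 1%:M - suppmx s = diag_mx (\row_i (s 0 i == 0)%:R).
  apply/matrixP => i j; rewrite !mxE; case: (i == j); rewrite ?mulr0n ?subr0 //.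
  by rewrite !mulr1n; case: eqP; rewrite ?subr0 ?subrr.
move=> le_m2; have := leq_trans le_m2 (leq_add rU (mxrank_diag_le _)).
rewrite -[X in (X <= _)%N](card_ord m2) -(cardC [pred i | s 0 i != 0]).
set c1 := #|[pred i | (\row__ _) _ _ != _]|; set c2 := #|[predC _]|.
suff -> : c1 = c2 by rewrite leq_add2r.
by apply: eq_card => i; rewrite !inE mxE pnatr_eq0 eqb0.
Qed.

Lemma sorted_singular_values : sorted >=%R (singular_values A).
Proof.
rewrite /singular_values rev_sorted.
apply: (homo_sorted _ _ (sorted_real_roots _)) => x y.
exact: ler_wsqrtr.
Qed.

Lemma singular_value_ge_minn j : (minn m1 m2 <= j)%N -> singular_value A j = 0.
Proof.
move=> mj; apply: (@nonincreasing_drop_eq0 _ _ (minn m1 m2)).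
- exact: sorted_singular_values.
- move=> x; rewrite (perm_mem singular_values_svd) => /mapP[i _ ->].
  by have [_ _ _] := svdA.
rewrite mj andbT (permP singular_values_svd) count_map.
apply: leq_trans card_svd_supp.
by rewrite cardE enumT -size_filter.
Qed.

Lemma nuclear_norm_svd : nuclear_norm A = \sum_i s 0 i.
Proof.
rewrite /nuclear_norm -(big_mkord xpredT (singular_value A)).
(* The definition stops at [minn m1 m2]; the terms from there to [m2] are zero. *)
transitivity (\sum_(0 <= j < m2) singular_value A j).
  rewrite [RHS](@big_cat_nat _ _ _ (minn m1 m2)) ?geq_minr //=.
  rewrite [X in _ + X]big_nat_cond [X in _ + X]big1 ?addr0 // => j.
  by rewrite andbT => /andP[mj _]; apply: singular_value_ge_minn.
have sz : size (singular_values A) = m2.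
  by rewrite (perm_size singular_values_svd) size_map size_enum_ord.
transitivity (\sum_(x <- singular_values A) x); first by rewrite [RHS](big_nth 0) sz.
by rewrite (perm_big _ singular_values_svd) big_map big_enum.
Qed.

(** Transfers the gap hypothesis, which concerns [singular_value], to the entries of [s]. *)
Lemma singular_value_of_svd i : s 0 i != 0 ->
  exists j : 'I_(minn m1 m2), singular_value A j = s 0 i.
Proof.
move=> si0; have : s 0 i \in singular_values A.
  by rewrite (perm_mem singular_values_svd); apply/mapP; exists i; rewrite ?mem_enum.
case/(nthP 0) => j _ sj; have [jm|mj] := ltnP j (minn m1 m2).
  by exists (Ordinal jm).
by move: si0; rewrite -sj -/(singular_value A j) singular_value_ge_minn ?eqxx.
Qed.

End SVD.

(** * Norms and duality *)

Section Norms.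
Variable R : realType.

Lemma mxdotE m n (A B : 'M[R]_(m, n)) : mxdot A B = \sum_j \sum_i A i j * B i j.
Proof.
by apply: eq_bigr => j _; rewrite mxE; apply: eq_bigr => i _; rewrite mxE.
Qed.

Lemma mxdotC m n (A B : 'M[R]_(m, n)) : mxdot A B = mxdot B A.
Proof. by rewrite /mxdot -mxtrace_tr trmx_mul trmxK. Qed.

Lemma mxdotDl m n (A B D : 'M[R]_(m, n)) : mxdot (A + B) D = mxdot A D + mxdot B D.
Proof. by rewrite /mxdot raddfD mulmxDl raddfD. Qed.

Lemma mxdotDr m n (A B D : 'M[R]_(m, n)) : mxdot D (A + B) = mxdot D A + mxdot D B.
Proof. by rewrite /mxdot mulmxDr raddfD. Qed.

Lemma mxdotZl m n a (A D : 'M[R]_(m, n)) : mxdot (a *: A) D = a * mxdot A D.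
Proof. by rewrite /mxdot linearZ /= -scalemxAl linearZ. Qed.

Lemma mxdotZr m n a (A D : 'M[R]_(m, n)) : mxdot D (a *: A) = a * mxdot D A.
Proof. by rewrite /mxdot -scalemxAr linearZ. Qed.

Lemma mxdotNl m n (A D : 'M[R]_(m, n)) : mxdot (- A) D = - mxdot A D.
Proof. by rewrite -scaleN1r mxdotZl mulN1r. Qed.

Lemma mxdotNr m n (A D : 'M[R]_(m, n)) : mxdot D (- A) = - mxdot D A.
Proof. by rewrite -scaleN1r mxdotZr mulN1r. Qed.

Lemma mxdot_mulr m n p (A : 'M[R]_(m, n)) (X : 'M[R]_(n, p)) B :
  mxdot (A *m X) B = mxdot A (B *m X^T).
Proof. by rewrite /mxdot trmx_mul -mulmxA mxtrace_mulC mulmxA. Qed.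

Lemma mxdot_mull m n p (A : 'M[R]_(n, p)) (X : 'M[R]_(m, n)) B :
  mxdot (X *m A) B = mxdot A (X^T *m B).
Proof. by rewrite /mxdot trmx_mul mulmxA. Qed.

Lemma frobenius_norm_ge0 m n (A : 'M[R]_(m, n)) : 0 <= frobenius_norm A.
Proof. exact: sqrtr_ge0. Qed.
Hint Resolve frobenius_norm_ge0 : core.

Lemma sqr_frobenius_norm m n (A : 'M[R]_(m, n)) : frobenius_norm A ^+ 2 = mxdot A A.
Proof.
rewrite sqr_sqrtr; last by do 2 apply: sumr_ge0 => ? _; apply: sqr_ge0.
by rewrite mxdotE exchange_big; do 2 apply: eq_bigr => ? _; rewrite expr2.
Qed.

Lemma mxdot_ge0 m n (A : 'M[R]_(m, n)) : 0 <= mxdot A A.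
Proof. by rewrite -sqr_frobenius_norm sqr_ge0. Qed.

Lemma mxdot_eq0 m n (A : 'M[R]_(m, n)) : mxdot A A = 0 -> A = 0.
Proof.
move=> A0; apply/matrixP => i j; have /colP/(_ i) : col j A = 0.
  apply: trmx_mul_self_eq0; move/eqP: A0; rewrite psumr_eq0 => [/allP A0|k _].
    by apply/eqP; exact: (A0 j (mem_index_enum j)).
  exact: trmx_mul_self_ge0.
by rewrite !mxE.
Qed.

Lemma frobenius_norm_eq0 m n (A : 'M[R]_(m, n)) : frobenius_norm A = 0 -> A = 0.
Proof. by move=> A0; apply: mxdot_eq0; rewrite -sqr_frobenius_norm A0 expr0n. Qed.

Lemma frobenius_norm_le m n p q (A : 'M[R]_(m, n)) (B : 'M[R]_(p, q)) :
  (frobenius_norm A <= frobenius_norm B) = (mxdot A A <= mxdot B B).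
Proof. by rewrite -!sqr_frobenius_norm ler_pXn2r ?nnegrE. Qed.

Lemma frobenius_norm0 m n : frobenius_norm (0 : 'M[R]_(m, n)) = 0.
Proof.
by apply/eqP; rewrite -sqrf_eq0 sqr_frobenius_norm -(scale0r 0) mxdotZl mul0r.
Qed.

(** Cauchy-Schwarz, from the square of [b *: A - a *: B], with [a] and [b] the norms of [A] and
    [B]. *)
Lemma mxdot_le m n (A B : 'M[R]_(m, n)) :
  mxdot A B <= frobenius_norm A * frobenius_norm B.
Proof.
set a := frobenius_norm A; set b := frobenius_norm B.
have [/frobenius_norm_eq0 A0|a0] := eqVneq a 0.
  by rewrite A0 -(scale0r 0) mxdotZl mul0r mulr_ge0 ?frobenius_norm_ge0.
have [/frobenius_norm_eq0 B0|b0] := eqVneq b 0.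
  by rewrite B0 -(scale0r 0) mxdotZr mul0r mulr_ge0 ?frobenius_norm_ge0.
have ab : 0 < a * b by rewrite mulr_gt0 // lt_def ?a0 ?b0 frobenius_norm_ge0.
have := mxdot_ge0 (b *: A - a *: B).
rewrite !(mxdotDl, mxdotDr, mxdotNl, mxdotNr, mxdotZl, mxdotZr).
rewrite -!sqr_frobenius_norm -/a -/b (mxdotC B A) => H.
by rewrite -(ler_pM2l ab); nra.
Qed.

Lemma frobenius_normD m n (A B : 'M[R]_(m, n)) :
  frobenius_norm (A + B) <= frobenius_norm A + frobenius_norm B.
Proof.
rewrite -(@ler_pXn2r _ 2) ?nnegrE ?addr_ge0 // sqr_frobenius_norm.
rewrite mxdotDl !mxdotDr (mxdotC B A) sqrrD !sqr_frobenius_norm.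
by have := mxdot_le A B; lra.
Qed.

Lemma frobenius_normZ m n a (A : 'M[R]_(m, n)) :
  frobenius_norm (a *: A) = `|a| * frobenius_norm A.
Proof.
apply/eqP; rewrite -(@eqrXn2 _ 2) ?mulr_ge0 // exprMn !sqr_frobenius_norm.
by rewrite mxdotZl mxdotZr mulrA -expr2 real_normK ?num_real.
Qed.

Lemma frobenius_normB m n (A B : 'M[R]_(m, n)) :
  frobenius_norm A <= frobenius_norm (A + B) + frobenius_norm B.
Proof.
rewrite -[X in frobenius_norm X <= _](addrK B) (le_trans (frobenius_normD _ _)) //.
by rewrite -scaleN1r frobenius_normZ normrN1 mul1r.
Qed.

(** [|A x|^2] is the product of [A] with [A x x^T], to which Cauchy-Schwarz applies. The set in
    [operator_norm] is thereby bounded, so that its [sup] is an upper bound. *)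
Lemma frobenius_norm_mul_cV m n (A : 'M[R]_(m, n)) (x : 'cV_n) :
  frobenius_norm (A *m x) <= frobenius_norm A * frobenius_norm x.
Proof.
have [->|Ax0] := eqVneq (frobenius_norm (A *m x)) 0; first by rewrite mulr_ge0.
have Axgt0 : 0 < frobenius_norm (A *m x) by rewrite lt_def Ax0 /=.
rewrite -(ler_pM2l Axgt0) -expr2 sqr_frobenius_norm mxdot_mulr.
apply: le_trans (mxdot_le _ _) _; rewrite mulrCA ler_wpM2l //.
rewrite -(@ler_pXn2r _ 2) ?nnegrE ?mulr_ge0 // exprMn !sqr_frobenius_norm.
rewrite mxdot_mulr trmxK -mulmxA.
by rewrite [x^T *m x]mx11_scalar mul_mx_scalar mxdotZr mulrC -trace_mx11.
Qed.

Lemma operator_norm_le m n (A : 'M[R]_(m, n)) (x : 'cV_n) :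
  frobenius_norm (A *m x) <= operator_norm A * frobenius_norm x.
Proof.
have [->|x0] := eqVneq x 0; first by rewrite mulmx0 !frobenius_norm0 mulr0.
have xgt0 : 0 < frobenius_norm x.
  by rewrite lt_def frobenius_norm_ge0 andbT; apply: contra_neq x0 => /frobenius_norm_eq0.
rewrite -ler_pdivrMr //; apply: sup_upper_bound; last first.
  exists ((frobenius_norm x)^-1 *: x) => /=.
    by rewrite frobenius_normZ ger0_norm ?invr_ge0 // mulVf ?gt_eqF.
  by rewrite -scalemxAr frobenius_normZ ger0_norm ?invr_ge0 // mulrC.
split.
  exists (frobenius_norm (A *m (0 : 'cV[R]_n))); exists 0 => //=.
  by rewrite frobenius_norm0 ler01.
exists (frobenius_norm A) => _ [y /= y1 <-].
by rewrite (le_trans (frobenius_norm_mul_cV _ _)) // ler_piMr.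
Qed.

End Norms.
#[local] Hint Extern 0 (is_true (0 <= frobenius_norm _)) =>
  solve [apply: frobenius_norm_ge0] : core.

(** * Duality between the nuclear and operator norms *)

Section NuclearNorm.
Variable R : realType.

Lemma mxdot_suppmx_le m n (s : 'rV[R]_m) (z : 'M[R]_(m, n)) :
  mxdot z (suppmx s *m z) <= mxdot z z.
Proof.
rewrite !mxdotE; do 2 apply: ler_sum => ? _; rewrite mul_diag_mx !mxE.
by case: (_ != _); rewrite ?mul1r // mul0r mulr0 -expr2 sqr_ge0.
Qed.

Lemma frobenius_norm_orthl m n (V : 'M[R]_m) (z : 'M[R]_(m, n)) :
  V^T *m V = 1%:M -> frobenius_norm (V *m z) = frobenius_norm z.
Proof.
move=> VTV; apply/eqP; rewrite -(@eqrXn2 _ 2) // !sqr_frobenius_norm.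
by rewrite mxdot_mull mulmxA VTV mul1mx.
Qed.

Lemma frobenius_norm_orthr m n (V : 'M[R]_n) (z : 'M[R]_(m, n)) :
  V *m V^T = 1%:M -> frobenius_norm (z *m V) = frobenius_norm z.
Proof.
move=> VVT; apply/eqP; rewrite -(@eqrXn2 _ 2) // !sqr_frobenius_norm.
by rewrite mxdot_mulr -mulmxA VVT mulmx1.
Qed.

Lemma mxdot_col m n (A B : 'M[R]_(m, n)) j :
  mxdot (col j A) (col j B) = \sum_i A i j * B i j.
Proof. by rewrite mxdotE big_ord1; apply: eq_bigr => i _; rewrite !mxE. Qed.

Lemma mxdot_self_col m n (A : 'M[R]_(m, n)) j :
  mxdot (col j A) (col j A) = (A^T *m A) j j.
Proof. by rewrite mxdot_col mxE; apply: eq_bigr => i _; rewrite mxE. Qed.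

Lemma col_mulmx m n p (A : 'M[R]_(m, n)) (B : 'M[R]_(n, p)) j :
  col j (A *m B) = A *m col j B.
Proof. by rewrite !colE mulmxA. Qed.

Section Duality.
Variables (m1 m2 : nat) (A U : 'M[R]_(m1, m2)) (V : 'M[R]_m2) (s : 'rV[R]_m2).
Hypothesis svdA : is_svd A U V s.

Lemma mxdot_svd (C : 'M[R]_(m1, m2)) :
  mxdot C A = \sum_j s 0 j * mxdot (C *m col j V^T) (col j U).
Proof.
have [-> VVT _ _] := svdA.
rewrite mxdotC mxdot_mulr mxdotC mxdotE; apply: eq_bigr => j _.
rewrite -col_mulmx mxdot_col mulr_sumr; apply: eq_bigr => i _.
by rewrite mul_mx_diag [X in _ * X = _]mxE; move: (_ i j) => a; ring.
Qed.

Lemma frobenius_norm_svd_left j : frobenius_norm (col j U) = (s 0 j != 0)%:R.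
Proof.
have [_ _ UTU _] := svdA.
apply/eqP; rewrite -(@eqrXn2 _ 2) ?ler0n // sqr_frobenius_norm mxdot_self_col UTU.
by rewrite !mxE eqxx mulr1n; case: (_ != _); rewrite ?expr1n ?expr0n.
Qed.

Lemma frobenius_norm_svd_right j : frobenius_norm (col j V^T) = 1.
Proof.
have [_ VVT _ _] := svdA.
apply/eqP; rewrite -(@eqrXn2 _ 2) ?ler01 // sqr_frobenius_norm mxdot_self_col.
by rewrite trmxK VVT mxE eqxx expr1n.
Qed.

(** [A] is the sum of the [s_j u_j v_j^T], and a contraction has product at most 1 with each
    [u_j v_j^T]. *)
Lemma mxdot_le_nuclear_norm (C : 'M[R]_(m1, m2)) :
  (forall y : 'cV_m2, frobenius_norm (C *m y) <= frobenius_norm y) ->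
  mxdot C A <= nuclear_norm A.
Proof.
move=> C1; rewrite mxdot_svd (nuclear_norm_svd svdA); apply: ler_sum => j _.
have [_ _ _ s0] := svdA; rewrite ler_piMr //.
apply: le_trans (mxdot_le _ _) _; rewrite frobenius_norm_svd_left.
have := C1 (col j V^T); rewrite frobenius_norm_svd_right.
by case: (_ != _); rewrite ?mulr1 // mulr0.
Qed.

(** [U *m V] is the partial isometry of the polar decomposition of [A]; it attains the bound of
    [mxdot_le_nuclear_norm]. *)
Lemma svd_sign_contraction (y : 'cV_m2) :
  frobenius_norm (U *m V *m y) <= frobenius_norm y.
Proof.
have [_ VVT UTU _] := svdA.
rewrite -(frobenius_norm_orthl y (mulmx1C VVT)) frobenius_norm_le -mulmxA.
by rewrite mxdot_mull mulmxA UTU mxdot_suppmx_le.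
Qed.

Lemma mxdot_svd_sign : mxdot (U *m V) A = nuclear_norm A.
Proof.
have [_ VVT UTU _] := svdA.
rewrite mxdot_svd (nuclear_norm_svd svdA); apply: eq_bigr => j _.
rewrite -col_mulmx -mulmxA VVT mulmx1 mxdot_self_col UTU !mxE eqxx mulr1n.
by have [->|_] := eqVneq (s 0 j) 0; rewrite ?mulr1 ?mulr0.
Qed.

Lemma svd_mulmx (z : 'cV[R]_m2) :
  A *m (V^T *m (suppmx s *m z)) = U *m (diag_mx s *m z).
Proof.
have [-> VVT _ _] := svdA.
rewrite -!mulmxA (mulmxA V) VVT mul1mx !mulmxA; congr (_ *m z).
by rewrite -mulmxA mul_diag_suppmx.
Qed.

Lemma frobenius_norm_svd_supp (z : 'cV[R]_m2) :
  frobenius_norm (V^T *m (suppmx s *m z)) = frobenius_norm (suppmx s *m z).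
Proof. by have [_ VVT _ _] := svdA; rewrite frobenius_norm_orthl // trmxK. Qed.

(** [z] and [q] hold coordinates along singular vectors; [|U q|^2] is the sum of the [q_j^2] over
    the support of [s]. *)
Lemma frobenius_norm_svd_ge (c : R) (z q : 'cV[R]_m2) : 0 <= c ->
  (forall j, s 0 j != 0 -> c * `|z j 0| <= `|q j 0|) ->
  c * frobenius_norm (suppmx s *m z) <= frobenius_norm (U *m q).
Proof.
have [_ _ UTU _] := svdA; move=> c0 zq.
rewrite -(@ler_pXn2r _ 2) ?nnegrE ?mulr_ge0 // exprMn !sqr_frobenius_norm.
rewrite mxdot_mull mulmxA UTU !mxdotE !big_ord1 mulr_sumr; apply: ler_sum => j _.
rewrite !mul_diag_mx !mxE; have [_|sj0] := eqVneq (s 0 j) 0.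
  by rewrite !mul0r !mulr0.
rewrite !mul1r -!expr2 -(real_normK (num_real (z j 0))).
rewrite -(real_normK (num_real (q j 0))) -exprMn.
by rewrite ler_pXn2r ?nnegrE ?mulr_ge0 ?zq.
Qed.

Lemma mxrank_svd_le : (\rank A <= \rank (suppmx s))%N.
Proof.
have [-> _ _ _] := svdA; rewrite -mul_diag_suppmx.
by rewrite (leq_trans (mxrankM_maxl _ _)) // mulmxA mxrankM_maxr.
Qed.

End Duality.

Lemma nuclear_norm_sign m1 m2 (A : 'M[R]_(m1, m2)) : exists G : 'M[R]_(m1, m2),
  (forall y : 'cV_m2, frobenius_norm (G *m y) <= frobenius_norm y) /\
  mxdot G A = nuclear_norm A.
Proof.
have [U [V [s svdA]]] := svd_exists A; exists (U *m V).
by split; [exact: svd_sign_contraction svdA|exact: mxdot_svd_sign svdA].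
Qed.

Lemma nuclear_norm_le m1 m2 (A : 'M[R]_(m1, m2)) (C : 'M[R]_(m1, m2)) :
  (forall y : 'cV_m2, frobenius_norm (C *m y) <= frobenius_norm y) ->
  mxdot C A <= nuclear_norm A.
Proof.
by have [U [V [s svdA]]] := svd_exists A; exact: mxdot_le_nuclear_norm svdA C.
Qed.

(** The contraction [G] attaining the nuclear norm of the sum is paired with [A] and with [x y^T]
    separately. *)
Lemma nuclear_normD_rank1_le m1 m2 (A : 'M[R]_(m1, m2)) (x : 'cV_m1) (y : 'cV_m2) :
  nuclear_norm (A + x *m y^T)
    <= nuclear_norm A + frobenius_norm x * frobenius_norm y.
Proof.
have [G [G1 <-]] := nuclear_norm_sign (A + x *m y^T).
rewrite mxdotDr lerD ?nuclear_norm_le // mxdotC mxdot_mulr trmxK.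
by rewrite (le_trans (mxdot_le _ _)) // ler_wpM2l.
Qed.

Lemma nuclear_normZ_le m1 m2 (A : 'M[R]_(m1, m2)) a : 0 <= a ->
  nuclear_norm (a *: A) <= a * nuclear_norm A.
Proof.
move=> a0; have [G [G1 <-]] := nuclear_norm_sign (a *: A).
by rewrite mxdotZr ler_wpM2l ?nuclear_norm_le.
Qed.

End NuclearNorm.

(** * First-order optimality at a proximal point *)

(** Division by [e], then [e] to 0; used to extract first-order conditions from minimality. *)
Lemma le_of_quadratic (R : realFieldType) (a b K : R) : 0 <= K ->
  (forall e, 0 < e -> e <= 1 -> e * a <= e ^+ 2 * K + e * b) -> a <= b.
Proof.
move=> K0 H; apply/ler_addgt0Pr => e e0.
(* Chosen so that [t * K <= e]; [K + 1] keeps the denominator positive. *)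
pose t := Num.min 1 (e / (K + 1)).
have K1 : 0 < K + 1 by rewrite ltr_wpDl.
have t0 : 0 < t by rewrite lt_min ltr01 divr_gt0.
have := H t t0; rewrite ge_min lexx => /(_ isT).
rewrite expr2 -mulrA -mulrDr ler_pM2l // => /le_trans; apply.
rewrite addrC lerD2l; apply: (@le_trans _ _ (t * (K + 1))).
  by rewrite ler_wpM2l ?ltW // ltrDl.
by rewrite -ler_pdivlMr // ge_min lexx orbT.
Qed.

(* The minimality of A in [penalized] is that of a proximal point: C plays the
   role of W - A, where A minimizes |A - W|^2 / 2 + tau |A|_1; then C is tau
   times a subgradient of the nuclear norm at A. *)
Section ProximalPoint.
Variables (R : realType) (m1 m2 : nat) (A C U : 'M[R]_(m1, m2)) (V : 'M[R]_m2).
Variables (s : 'rV[R]_m2) (tau : R).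
Hypothesis svdA : is_svd A U V s.
Hypothesis tau_ge0 : 0 <= tau.
Hypothesis penalized : forall B : 'M[R]_(m1, m2),
  2 * mxdot C B <= mxdot B B + 2 * tau * (nuclear_norm (A + B) - nuclear_norm A).

(** The perturbation [e x y^T] with [x = C y] has product [e |x|^2] with [C] and raises the nuclear
    norm by at most [e |x| |y|]. *)
Lemma proximal_bound (y : 'cV[R]_m2) :
  frobenius_norm (C *m y) <= tau * frobenius_norm y.
Proof.
have [->|Cy0] := eqVneq (frobenius_norm (C *m y)) 0; first by rewrite mulr_ge0.
have Cy_gt0 : 0 < frobenius_norm (C *m y) by rewrite lt_def Cy0 /=.
set x := C *m y in Cy0 Cy_gt0 *.
rewrite -(ler_pM2l Cy_gt0) -expr2 sqr_frobenius_norm -[leLHS]mulr1 -[leRHS]mulr1.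
rewrite -(@ler_pM2r _ 2) // -!mulrA mul1r.
apply: (@le_of_quadratic _ _ _ (mxdot (x *m y^T) (x *m y^T))).
  exact: mxdot_ge0.
move=> e e0 e1; have := penalized (e *: (x *m y^T)).
have := nuclear_normD_rank1_le A (e *: x) y.
rewrite -scalemxAl frobenius_normZ gtr0_norm // => nD.
have -> : mxdot C (e *: (x *m y^T)) = e * mxdot x x.
  by rewrite mxdotZr mxdotC mxdot_mulr trmxK.
rewrite mxdotZr mxdotZl => H.
have {nD} := ler_wpM2l (mulr_ge0 (ler0n R 2) tau_ge0) nD.
lra.
Qed.

(** The perturbation [- e A] rescales [A] by [1 - e], which lowers its nuclear norm by at least [e]
    times that norm. *)
Lemma proximal_dual : tau * nuclear_norm A <= mxdot C A.
Proof.
rewrite -(@ler_pM2r _ 2) // -lerN2.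
apply: (@le_of_quadratic _ _ _ (mxdot A A)); first exact: mxdot_ge0.
move=> e e0 e1; have := penalized (- e *: A).
rewrite -[X in nuclear_norm (X + _)]scale1r -scalerDl mxdotZr mxdotZl mxdotZr.
have e1' : 0 <= 1 - e by rewrite subr_ge0.
have := ler_wpM2l (mulr_ge0 (ler0n R 2) tau_ge0) (nuclear_normZ_le A e1').
lra.
Qed.

(** Equality case of duality: [proximal_bound] gives [s_j d_j <= s_j tau] for each [j],
    [proximal_dual] the reverse for the sums, so [d_j = tau] on the support. *)
Lemma proximal_svd : C *m V^T *m suppmx s = tau *: U.
Proof.
have [_ _ _ s0] := svdA.
pose d j := mxdot (C *m col j V^T) (col j U).
have d_le j : s 0 j * d j <= s 0 j * tau.
  rewrite ler_wpM2l // (le_trans (mxdot_le _ _)) //.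
  rewrite (frobenius_norm_svd_left svdA).
  have := proximal_bound (col j V^T); rewrite (frobenius_norm_svd_right svdA).
  by rewrite mulr1; case: (_ != _); rewrite ?mulr1 ?mulr0.
have := proximal_dual; rewrite (nuclear_norm_svd svdA) (mxdot_svd svdA) mulr_sumr.
rewrite -subr_le0 -sumrB => sum_le0.
have /eqP : \sum_j (tau * s 0 j - s 0 j * d j) = 0.
  apply/eqP; rewrite eq_le sum_le0 sumr_ge0 // => j _.
  by rewrite subr_ge0 [tau * _]mulrC.
rewrite psumr_eq0 => [/allP d_eq|j _]; last by rewrite subr_ge0 [tau * _]mulrC.
apply/matrixP => i j; rewrite mul_mx_diag !mxE.
have [sj0|sj0] := eqVneq (s 0 j) 0.
  have := frobenius_norm_svd_left svdA j; rewrite sj0 eqxx.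
  by move=> /frobenius_norm_eq0/colP/(_ i); rewrite !mxE mulr0 => ->; rewrite mulr0.
have dj : d j = tau.
  have := d_eq j (mem_index_enum j); rewrite /= subr_eq0 [tau * _]mulrC => /eqP dj.
  by apply: (mulfI sj0).
(* The expansion is [|C v_j|^2 - 2 tau^2 + tau^2], at most 0 since [|C v_j| <= tau]. *)
have : mxdot (C *m col j V^T - tau *: col j U) (C *m col j V^T - tau *: col j U) = 0.
  apply/eqP; rewrite eq_le mxdot_ge0 andbT.
  rewrite !(mxdotDl, mxdotDr, mxdotNl, mxdotNr, mxdotZl, mxdotZr).
  rewrite (mxdotC (col j U) (C *m _)) -/(d j) dj -!sqr_frobenius_norm.
  rewrite (frobenius_norm_svd_left svdA) sj0.
  have := proximal_bound (col j V^T); rewrite (frobenius_norm_svd_right svdA) mulr1.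
  have := frobenius_norm_ge0 (C *m col j V^T); rewrite expr1n.
  by move: (frobenius_norm _) => x x0 xt; nra.
by move/mxdot_eq0/colP/(_ i)/eqP; rewrite -col_mulmx !mxE subr_eq0 mulr1 => /eqP.
Qed.

End ProximalPoint.

(** * Rank comparison and lower bound on the error *)

Section Thresholding.
Variables (R : realType) (m1 m2 : nat) (A A0 M : 'M[R]_(m1, m2)) (tau delta : R).
Hypotheses (tau_gt0 : 0 < tau) (delta_gt0 : 0 < delta).
Hypothesis M_le : forall y : 'cV[R]_m2,
  frobenius_norm (M *m y) <= (1 - delta) * tau * frobenius_norm y.
Let C := A0 + M - A.
Hypothesis penalized : forall B : 'M[R]_(m1, m2),
  2 * mxdot C B <= mxdot B B + 2 * tau * (nuclear_norm (A + B) - nuclear_norm A).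

Let C_svd U V s : is_svd A U V s -> C *m V^T *m suppmx s = tau *: U.
Proof. by move=> svdA; apply: proximal_svd (ltW tau_gt0) penalized. Qed.

Let C_le (y : 'cV[R]_m2) : frobenius_norm (C *m y) <= tau * frobenius_norm y.
Proof. exact: proximal_bound (ltW tau_gt0) penalized _. Qed.

Lemma mxrank_proximal_le : (\rank A <= \rank A0)%N.
Proof.
have [U [V [s svdA]]] := svd_exists A.
apply: leq_trans (mxrank_svd_le svdA) _.
(* [V^T *m suppmx s] parametrizes the row space of [A], on which [A0] has to be injective. *)
apply: leq_trans (mxrankM_maxl A0 (V^T *m suppmx s)).
apply: mxrank_le_ker => z; rewrite -!mulmxA; set y := V^T *m _ => A0y.
have My : M *m y = U *m (tau *: z + diag_mx s *m z).
  have -> : M = C + A - A0 by rewrite /C subrK addrC addKr.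
  rewrite mulmxBl A0y subr0 mulmxDl (svd_mulmx svdA) mulmxDr; congr (_ + _).
  by rewrite /y !mulmxA (C_svd svdA) -scalemxAl -scalemxAr.
have /(frobenius_norm_svd_ge svdA (ltW tau_gt0)) : forall j, s 0 j != 0 ->
    tau * `|z j 0| <= `|(tau *: z + diag_mx s *m z) j 0|.
  move=> j _; rewrite mul_diag_mx !mxE -mulrDl normrM ler_wpM2r //.
  have [_ _ _ /(_ j) s0] := svdA.
  by rewrite ger0_norm ?lerDl // addr_ge0 // ltW.
(* [tau |y| <= |M y| <= (1 - delta) tau |y|] forces [y = 0]. *)
rewrite -My => /le_trans /(_ (M_le y)).
rewrite (frobenius_norm_svd_supp svdA) => H.
apply: frobenius_norm_eq0; apply/eqP; rewrite eq_le frobenius_norm_ge0 andbT.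
have : 0 < delta * tau by rewrite mulr_gt0.
have := frobenius_norm_ge0 (suppmx s *m z); nra.
Qed.

Hypothesis gap : forall j : 'I_(minn m1 m2), singular_value A0 j != 0 ->
  2 * tau <= singular_value A0 j.

Lemma mxrank_proximal_ge : (\rank A0 <= \rank A)%N.
Proof.
have [U [V [s svdA0]]] := svd_exists A0.
apply: leq_trans (mxrank_svd_le svdA0) _.
apply: leq_trans (mxrankM_maxl A (V^T *m suppmx s)).
apply: mxrank_le_ker => z; rewrite -!mulmxA; set y := V^T *m _ => Ay.
have /(frobenius_norm_svd_ge svdA0 (mulr_ge0 (ler0n R 2) (ltW tau_gt0))) :
    forall j, s 0 j != 0 -> 2 * tau * `|z j 0| <= `|(diag_mx s *m z) j 0|.
  move=> j sj0; rewrite mul_diag_mx !mxE normrM ler_wpM2r //.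
  have [_ _ _ s0] := svdA0; rewrite ger0_norm //.
  have [k sk] := singular_value_of_svd svdA0 sj0.
  by rewrite -sk gap // sk.
rewrite -(svd_mulmx svdA0) -/y -(frobenius_norm_svd_supp svdA0) -/y => H.
have A0y : A0 *m y + M *m y = C *m y by rewrite /C mulmxBl Ay subr0 mulmxDl.
have := frobenius_normB (A0 *m y) (M *m y); rewrite A0y.
have := C_le y; have := M_le y => My Cy tri.
suff y0 : frobenius_norm y = 0.
  by apply: frobenius_norm_eq0; rewrite -(frobenius_norm_svd_supp svdA0).
apply/eqP; rewrite eq_le frobenius_norm_ge0 andbT.
(* The bounds combine to [2 tau |y| <= tau |y| + (1 - delta) tau |y|], that is
   [delta tau |y| <= 0]. *)
have : 0 < delta * tau by rewrite mulr_gt0.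
have := frobenius_norm_ge0 y; nra.
Qed.

(** The orthogonal [V^T] splits the squared norm into the [|(A - A0) v_j|^2]. On the support,
    [(A - A0) v_j = M v_j - tau u_j] has length at least [tau - (1 - delta) tau]. *)
Lemma frobenius_norm_proximal_ge :
  (\rank A0)%:R * (delta * tau) ^+ 2 <= frobenius_norm (A - A0) ^+ 2.
Proof.
have [U [V [s svdA]]] := svd_exists A; have [_ VVT _ _] := svdA.
have dt0 : 0 <= delta * tau by rewrite mulr_ge0 // ltW.
apply: (@le_trans _ _ (#|[pred i | s 0 i != 0]|%:R * (delta * tau) ^+ 2)).
  rewrite ler_wpM2r ?sqr_ge0 // ler_nat (leq_trans mxrank_proximal_ge) //.
  rewrite (leq_trans (mxrank_svd_le svdA)) // (leq_trans (mxrank_diag_le _)) //.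
  apply: eq_leq; apply: eq_card => i; rewrite !inE mxE.
  by case: (s 0 i == 0); rewrite /= ?eqxx ?oner_eq0.
rewrite -(frobenius_norm_orthr (A - A0) (_ : V^T *m V^T^T = 1%:M)); last first.
  by rewrite trmxK (mulmx1C VVT).
rewrite sqr_frobenius_norm mxdotE -sum1_card natr_sum mulr_suml big_mkcond /=.
apply: ler_sum => j _; rewrite -mxdot_col -sqr_frobenius_norm.
rewrite inE; case: ifP => sj0; last exact: sqr_ge0.
rewrite mul1r ler_pXn2r ?nnegrE //.
have uj : frobenius_norm (col j U) = 1 by rewrite (frobenius_norm_svd_left svdA) sj0.
have Cv : C *m col j V^T = tau *: col j U.
  have := congr1 (col j) (C_svd svdA); rewrite linearZ /= => <-.
  apply/colP => i; rewrite -col_mulmx [LHS]mxE [RHS]mxE mul_mx_diag !mxE.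
  by rewrite sj0 mulr1.
have -> : A - A0 = M - C.
  by rewrite /C opprB addrCA [A0 + M]addrC opprD [M + _]addrA subrr add0r.
rewrite col_mulmx mulmxBl Cv.
have := frobenius_normB (- (tau *: col j U)) (M *m col j V^T).
rewrite -scaleNr frobenius_normZ uj mulr1 normrN gtr0_norm // scaleNr [- _ + _]addrC.
have := M_le (col j V^T); rewrite (frobenius_norm_svd_right svdA) mulr1.
lra.
Qed.

End Thresholding.

(** * Matrix completion with a uniform design *)

Section UniformDesign.
Context {d : measure_display} {T : measurableType d} {R : realType}.
Variables (P : probability T R) (m1 m2 : nat).
Hypotheses (m1_gt0 : (0 < m1)%N) (m2_gt0 : (0 < m2)%N).
Variables (X : T -> 'M[R]_(m1, m2)) (Y : T -> R) (A0 : 'M[R]_(m1, m2)).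
Hypotheses (mX : forall j k, measurable_fun setT (fun w => X w j k))
  (mY : measurable_fun setT Y).

(** A finite intersection of events on single entries. Membership in [sigma_mx X] is what allows
    conditioning on this event. *)
Lemma sigma_mx_preimage_set1 (x : 'M[R]_(m1, m2)) : sigma_mx X (X @^-1` [set x]).
Proof.
pose G := \bigcup_jk preimage_set_system setT
  (fun w => X w jk.1 jk.2) measurable : set (set T).
have -> : X @^-1` [set x] =
    \bigcap_(jk in [set: 'I_m1 * 'I_m2]) [set w | X w jk.1 jk.2 = x jk.1 jk.2].
  apply/seteqP; split=> w /=; first by move=> Xw jk _ /=; rewrite Xw.
  by move=> Xw; apply/matrixP => j k; exact: (Xw (j, k)).
apply: (@fin_bigcap_measurable _ (g_sigma_algebraType G)) => // jk _.
apply: sub_sigma_algebra; exists jk => //; exists [set x jk.1 jk.2] => //.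
by rewrite setTI.
Qed.

Lemma sigma_mx_sub_measurable : sigma_mx X `<=` measurable.
Proof.
apply: smallest_sub; first exact: sigma_algebra_measurable.
by move=> _ [jk _ [B mB <-]]; exact: mX.
Qed.

Lemma measurable_preimage_set1_mx x : measurable (X @^-1` [set x]).
Proof. by apply: sigma_mx_sub_measurable; exact: sigma_mx_preimage_set1. Qed.

Hypothesis unifX : uniform_on_mx_units P X.

(** The [m1 * m2] disjoint events [B jk] have equal masses that add up to 1. *)
Lemma uniform_on_mx_units_ae : {ae P, forall w, mx_units (X w)}.
Proof.
pose B (jk : 'I_m1 * 'I_m2) := X @^-1` [set delta_mx jk.1 jk.2].
have mB jk : measurable (B jk) by exact: measurable_preimage_set1_mx.
have tB : trivIset setT B.
  apply/trivIsetP => -[j k] [j' k'] _ _ jk; rewrite -subset0 => w [Bw Bw'].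
  have /matrixP/(_ j k)/eqP : delta_mx j k = delta_mx j' k' :> 'M[R]_(m1, m2).
    by rewrite -Bw -Bw'.
  by rewrite !mxE !eqxx -xpair_eqE (negPf jk) oner_eq0.
have PB : P (\bigcup_jk B jk) = 1%E.
  rewrite measure_fin_bigcup //; last exact: finite_finset.
  have -> : [set: 'I_m1 * 'I_m2] = [set` index_enum ('I_m1 * 'I_m2)%type].
    by apply/seteqP; split => // jk _ /=; rewrite mem_index_enum.
  rewrite -fsbig_seq ?index_enum_uniq //.
  rewrite (eq_bigr (fun=> (((m1 * m2)%:R)^-1)%:E)); last first.
    by move=> jk _; apply: unifX; exists jk.
  rewrite sumEFin sumr_const card_prod !card_ord -[_ *+ _]mulr_natr mulVf //.
  by rewrite pnatr_eq0 -lt0n muln_gt0 m1_gt0.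
exists (~` \bigcup_jk B jk); split.
- by apply: measurableC; apply: fin_bigcup_measurable.
- by rewrite probability_setC ?PB ?subee //; apply: fin_bigcup_measurable.
apply: subsetC => w [jk _ Bw]; exists jk => //.
Qed.

Hypothesis condY :
  is_cond_expectation P (sigma_mx X) Y (fun w => \tr ((X w)^T *m A0)).

(** Almost surely the entry [X w j k] is the indicator of [B]. The expectation is thus the integral
    of [Y] over [B], hence that of [tr (X^T A0)], which equals [A0 j k] there. *)
Lemma mx_expectation_uniform :
  mx_expectation P (fun w => Y w *: X w) = (m1 * m2)%:R^-1 *: A0.
Proof.
have [iY iZ mZ YZ] := condY.
apply/matrixP => j k; rewrite !mxE unlock.
pose B := X @^-1` [set delta_mx j k].
have mB : measurable B by exact: measurable_preimage_set1_mx.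
rewrite (_ : (\int[P]_w _)%E = (\int[P]_(w in B) (Y w)%:E)%E); last first.
  rewrite [RHS]integral_mkcond; apply: ae_eq_integral => //.
  - apply/measurable_EFinP; rewrite (_ : (fun w => _) = Y \* (fun w => X w j k)).
      exact: measurable_funM.
    by apply/funext => w; rewrite mxE.
  - apply: (iffLR (measurable_restrictT _ mB)); apply: measurable_funTS.
    exact/measurable_EFinP.
  apply: filterS uniform_on_mx_units_ae => w [[j' k'] _ /= Xw] _.
  rewrite patchE mxE -Xw mxE; case: ifPn => [|wB].
    rewrite inE /B /= -Xw => /matrixP/(_ j k); rewrite !mxE => ->.
    by rewrite !eqxx mulr1.
  have [/andP[/eqP jj' /eqP kk']|_] := boolP (_ && _); last by rewrite mulr0.
  by move: wB; rewrite notin_setE /B /= -Xw jj' kk'.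
rewrite YZ; last exact: sigma_mx_preimage_set1.
rewrite (eq_integral (cst (A0 j k)%:E)); last first.
  move=> w; rewrite inE => /= ->; congr EFin.
  have E i : (delta_mx k j *m A0) i i = (i == k)%:R * A0 j i.
    rewrite mxE (bigD1 j) //= big1 => [|l lj]; rewrite !mxE.
      by rewrite eqxx andbT addr0.
    by rewrite (negPf lj) andbF mul0r.
  rewrite trmx_delta /mxtrace (bigD1 k) //= big1 => [|i /negPf ik].
    by rewrite E eqxx mul1r addr0.
  by rewrite E ik mul0r.
rewrite integral_cst //= unifX; last by exists (j, k).
by rewrite -EFinM /= mulrC.
Qed.

End UniformDesign.

(** Minimality against [Ahat + B], multiplied by [m1 * m2] and expanded; the terms linear in [B]
    form the left side. *)
Lemma estimator_penalized (R : realType) n m1 m2 (x : 'I_n -> 'M[R]_(m1, m2))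
    (y : 'I_n -> R) lambda (Ahat B : 'M[R]_(m1, m2)) :
  (0 < m1 * m2)%N -> is_estimator x y lambda Ahat ->
  2 * mxdot (((m1 * m2)%:R / n%:R) *: (\sum_(i < n) y i *: x i) - Ahat) B
    <= mxdot B B + (m1 * m2)%:R * lambda
                   * (nuclear_norm (Ahat + B) - nuclear_norm Ahat).
Proof.
move=> m_gt0 /(_ (Ahat + B)); rewrite /objective.
set S := \sum_i _; set N : R := (m1 * m2)%:R.
have N_gt0 : 0 < N by rewrite ltr0n.
rewrite !sqr_frobenius_norm !(mxdotDl, mxdotDr, mxdotNl, mxdotZl) (mxdotC B Ahat).
rewrite -(ler_pM2l N_gt0) !mulrDr !mulrN !mulrA divff ?gt_eqF // !mul1r.
lra.
Qed.

Theorem theorem8 (d : measure_display) (T : measurableType d) (R : realType)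
    (P : probability T R) (n m1 m2 : nat)
    (n_gt0 : (0 < n)%N) (m1_gt0 : (0 < m1)%N) (m2_gt0 : (0 < m2)%N)
    (X : 'I_n -> T -> 'M[R]_(m1, m2)) (Y : 'I_n -> T -> R)
    (A0 : 'M[R]_(m1, m2))
    (mX : forall i j k, measurable_fun setT (fun w => X i w j k))
    (mY : forall i, measurable_fun setT (Y i))
    (indepXY : independent_sigma P (fun i => sigma_pair (X i) (Y i)))
    (condY : forall i, is_cond_expectation P (sigma_mx (X i)) (Y i)
                         (fun w => \tr ((X i w)^T *m A0)))
    (unifX : forall i, uniform_on_mx_units P (X i))
    (lambda delta : R) (lambda_gt0 : 0 < lambda)
    (delta_gt0 : 0 < delta) (delta_lt1 : delta < 1)
    (w : T) (lambda_ge : 2 * operator_norm (noise_mx P X Y w) <= lambda)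
    (Ahat : 'M[R]_(m1, m2))
    (hAhat : is_estimator (fun i => X i w) (fun i => Y i w)
               (lambda / (1 - delta)) Ahat) :
  (\rank Ahat <= \rank A0)%N /\
  ((forall j : 'I_(minn m1 m2), singular_value A0 j != 0 ->
      lambda / (1 - delta) * (m1 * m2)%:R <= singular_value A0 j) ->
   (\rank A0 <= \rank Ahat)%N /\
   delta ^+ 2 / (4 * (1 - delta) ^+ 2) * (\rank A0)%:R
     * (lambda * (m1 * m2)%:R) ^+ 2
   <= frobenius_norm (Ahat - A0) ^+ 2).
Proof.
have m_gt0 : (0 < m1 * m2)%N by rewrite muln_gt0 m1_gt0.
set N : R := (m1 * m2)%:R; set lambda' := lambda / (1 - delta).
have N_gt0 : 0 < N by rewrite ltr0n.
have d1_gt0 : 0 < 1 - delta by rewrite subr_gt0.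
(* With this scaling the gap is [2 tau], and [lambda_ge] bounds the operator norm of [M] by
   [(1 - delta) tau]. *)
pose M := N *: noise_mx P X Y w; pose tau := N * lambda' / 2.
have tau_gt0 : 0 < tau by rewrite !mulr_gt0 ?invr_gt0.
have tauE : (1 - delta) * tau = N * lambda / 2.
  by rewrite /tau /lambda'; field; rewrite gt_eqF.
have A0M : A0 + M = (N / n%:R) *: \sum_(i < n) Y i w *: X i w.
  rewrite /M /noise_mx sumrB.
  under [X in _ - X]eq_bigr => i _.
    rewrite (mx_expectation_uniform m1_gt0 m2_gt0 (mX i) (mY i) (unifX i)
      (condY i)).
    over.
  rewrite sumr_const card_ord -[_ *: A0 *+ n]scaler_nat !scalerBr !scalerA.
  (* The [n] equal means [A0 / N], averaged and multiplied by [N], give back [A0]. *)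
  set c := (X in _ - X *: A0); have -> : c = 1.
    by rewrite /c -/N; field; rewrite !gt_eqF ?ltr0n.
  by rewrite scale1r addrC subrK.
have M_le (y : 'cV[R]_m2) :
    frobenius_norm (M *m y) <= (1 - delta) * tau * frobenius_norm y.
  rewrite tauE -scalemxAl frobenius_normZ gtr0_norm //.
  apply: le_trans (ler_wpM2l (ltW N_gt0) (operator_norm_le _ _)) _.
  rewrite -2!mulrA (ler_wpM2l (ltW N_gt0)) // ler_wpM2r ?frobenius_norm_ge0 //.
  by rewrite ler_pdivlMr // mulrC.
have penalized (B : 'M[R]_(m1, m2)) : 2 * mxdot (A0 + M - Ahat) B <=
    mxdot B B + 2 * tau * (nuclear_norm (Ahat + B) - nuclear_norm Ahat).
  have -> : 2 * tau = N * lambda' by rewrite /tau mulrC divfK.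
  by rewrite A0M; exact: estimator_penalized.
split; first exact: mxrank_proximal_le delta_gt0 M_le penalized.
have -> : lambda' * N = 2 * tau by rewrite /tau [2 * _]mulrC divfK // mulrC.
move=> gap; split; first exact: mxrank_proximal_ge delta_gt0 M_le penalized gap.
apply: le_trans (frobenius_norm_proximal_ge tau_gt0 delta_gt0 M_le penalized gap).
rewrite le_eqVlt; apply/orP; left; apply/eqP.
by rewrite /tau /lambda'; field; rewrite gt_eqF.
Qed.
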